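(* Let $p$ be a prime and $f$ a positive integer. A subgroup $H$ of $\Gamma\mathrm{L}_1(p^f)=\langle a\rangle{:}\langle\varphi\rangle$ is minimally transitive on $\mathbb{F}_{p^f}^\times$ if and only if there exist some divisor $k$ of $f$, subset $\sigma$ of $\pi(p^k-1)\cap\pi(f)$ and generator $c$ of $\langle a\rangle_\sigma$ such that $k$ is divisible by $f_{\sigma'}$ and one of the following holds: (a) $H=\langle a\rangle_{\sigma'}{:}\langle c\varphi^k\rangle$ with either $2\notin\sigma$ or $p^k\equiv1\pmod4$; (b) $H=\langle a\rangle_{\sigma'}{:}(\langle a^2\rangle_2\langle c\varphi^k\rangle)$ with $2\in\sigma$ and $p^k\equiv3\pmod4$. Moreover, such an $H$ is regular on $\mathbb{F}_{p^f}^\times$ if and only if either case (a) holds, or $f\equiv2\pmod4$ and case (b) holds; in particular, a Sylow subgroup of a regular subgroup of $\Gamma\mathrm{L}_1(p^f)$ on $\mathbb{F}_{p^f}^\times$ is either cyclic or a generalized quaternion $2$-group.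
   Context: Let $\omega$ be a generator of $\mathbb{F}_{p^f}^\times$, let $a\in\mathrm{GL}_1(p^f)$ be multiplication by $\omega$, and let $\varphi$ be the Frobenius $x\mapsto x^p$ of $\mathbb{F}_{p^f}$. Then $\Gamma\mathrm{L}_1(p^f)=\langle a\rangle{:}\langle\varphi\rangle$ with $|a|=p^f-1$, $|\varphi|=f$, $a^\varphi=a^p$ (permutations act on the right), acting on $\mathbb{F}_{p^f}^\times$. For a positive integer $n$, $\pi(n)$ is its set of prime divisors; for a set $\sigma$ of primes, $n_\sigma$ is the largest divisor $\ell$ of $n$ with $\pi(\ell)\subseteq\sigma$, and $n_{\sigma'}=n/n_\sigma$. For a cyclic group $C$ of order $n$, $C_\sigma$ and $C_{\sigma'}$ are its unique subgroups of order $n_\sigma$ and $n_{\sigma'}$. When $\sigma=\{r\}$, write $r$ for the subscript $\sigma$. A subgroup is minimally transitive if it is transitive and none of its proper subgroups is transitive. $A{:}B$ denotes an (internal) semidirect product with $A$ normal. *)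

(* Defs.v *)
From HB Require Import structures.
From mathcomp Require Import all_boot all_order all_algebra all_fingroup.
From mathcomp Require Import all_solvable all_field.

Set Implicit Arguments.
Unset Strict Implicit.
Unset Printing Implicit Defensive.

Import GRing.Theory.
Local Open Scope group_scope.

Section Transitivity.
Variables (T : finType).
Implicit Types (G : {group {perm T}}) (S : {set T}).

Definition minimally_transitive G S : Prop :=
  [transitive G, on S | 'P] /\
  forall K : {group {perm T}}, K \proper G -> ~~ [transitive K, on S | 'P].

Definition regular_on G S : Prop :=
  [transitive G, on S | 'P] /\ {in S, forall x, 'C_G[x | 'P] = 1}.

End Transitivity.

(* For cyclic C this is the unique subgroup of order #|C|`_pi: see            *)
(* cyclic_part_spec and cyclic_part_uniq.                                     *)
Definition cyclic_part (gT : finGroupType) (C : {group gT}) (pi : nat_pred)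
    : {group gT} :=
  odflt 1%G [pick K : {group gT} | (K \subset C) && (#|K| == #|C|`_pi)%N].

Lemma cyclic_part_spec (gT : finGroupType) (C : {group gT}) (pi : nat_pred) :
  cyclic C -> cyclic_part C pi \subset C /\ #|cyclic_part C pi| = (#|C|`_pi)%N.
Proof.
move=> cycC; rewrite /cyclic_part; case: pickP => [K /andP[sKC /eqP oK] //|noK].
have [x defC] := cyclicP cycC.
have := noK 'O_pi(C)%G; rewrite pcore_sub.
have hallC : pi.-Hall(C) 'O_pi(C).
  exact/nilpotent_pcore_Hall/abelian_nil/cyclic_abelian.
by rewrite (card_Hall hallC) eqxx.
Qed.

Lemma cyclic_part_uniq (gT : finGroupType) (C K : {group gT}) (pi : nat_pred) :
  cyclic C -> K \subset C -> #|K| = (#|C|`_pi)%N -> cyclic_part C pi = K.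
Proof.
move=> cycC sKC oK; have [sPC oP] := cyclic_part_spec pi cycC.
by apply/val_inj/eqP; rewrite /= (eq_subG_cyclic cycC) // oP oK.
Qed.

Section GammaL1.
Variables (F : finFieldType) (w : {unit F}) (p : nat) (pcharFp : p \in [pchar F]%R).

Definition units_set : {set F} := [set x : F | x != 0%R].

Definition mul_perm : {perm F} := perm (mulrI (valP w)).

Definition Frobenius_perm : {perm F} :=
  perm (fmorph_inj (pFrobenius_aut pcharFp)).

Definition GammaL1 : {group {perm F}} :=
  (<[mul_perm]> <*> <[Frobenius_perm]>)%G.

Lemma mul_permE (x : F) : mul_perm x = (val w * x)%R.
Proof. by rewrite permE. Qed.

Lemma Frobenius_permE (x : F) : Frobenius_perm x = (x ^+ p)%R.
Proof. by rewrite permE. Qed.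

Lemma mul_permX_E n (x : F) : (mul_perm ^+ n) x = (val w ^+ n * x)%R.
Proof.
elim: n => [|n IHn]; first by rewrite perm1 GRing.expr0 mul1r.
by rewrite expgSr permM IHn mul_permE GRing.exprS mulrA.
Qed.

Lemma Frobenius_permX_E n (x : F) : (Frobenius_perm ^+ n) x = (x ^+ (p ^ n)%N)%R.
Proof.
elim: n => [|n IHn]; first by rewrite perm1 expn0 GRing.expr1.
by rewrite expgSr permM IHn Frobenius_permE -GRing.exprM expnSr.
Qed.

Lemma mul_perm_conj : mul_perm ^ Frobenius_perm = mul_perm ^+ p.
Proof.
apply/permP=> x; rewrite -[x](permKV Frobenius_perm).
by rewrite permJ mul_permX_E mul_permE !Frobenius_permE GRing.exprMn.
Qed.

Lemma order_mul_perm : generator [set: {unit F}] w -> #[mul_perm] = #|F|.-1.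
Proof.
move=> genw; have ow : #[w] = #|F|.-1.
  by rewrite orderE -(eqP genw) card_finField_unit.
rewrite -ow; apply/eqP; rewrite eqn_dvd !order_dvdn; apply/andP; split.
  by apply/eqP/permP=> x; rewrite mul_permX_E -FinRing.val_unitX expg_order perm1 mul1r.
apply/eqP/val_inj; rewrite FinRing.val_unitX.
by rewrite -[LHS]mulr1 -mul_permX_E expg_order perm1.
Qed.

Lemma order_Frobenius_perm f : 0 < f -> #|F| = (p ^ f)%N -> #[Frobenius_perm] = f.
Proof.
move=> f_gt0 cardF; have p_gt1 := prime_gt1 (pcharf_prime pcharFp).
have of_dv : #[Frobenius_perm] %| f.
  rewrite order_dvdn; apply/eqP/permP=> x.
  by rewrite Frobenius_permX_E -cardF expf_card perm1.
apply/eqP; rewrite eqn_leq dvdn_leq //=.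
rewrite -(leq_exp2l _ _ p_gt1) -cardF.
set m := #[_]; set P := ('X^(p ^ m)%N - 'X : {poly F})%R.
have pm_gt1 : 1 < p ^ m by rewrite -(expn0 p) ltn_exp2l ?order_gt0.
have sP : size P = (p ^ m).+1.
  by rewrite size_polyDl ?size_polyXn // size_polyN size_polyX ltnS.
have P0 : P != 0%R by rewrite -size_poly_eq0 sP.
have := @max_poly_roots _ P (enum F) P0.
rewrite sP -cardE ltnS => -> //; last exact: enum_uniq.
apply/allP=> x _; rewrite rootE !hornerE subr_eq0.
by rewrite -Frobenius_permX_E expg_order perm1.
Qed.

Lemma GammaL1_sdprod : <[mul_perm]> ><| <[Frobenius_perm]> = GammaL1.
Proof.
apply: sdprodEY.
  by rewrite cycle_subG; apply/normP; rewrite -cycleJ mul_perm_conj;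
     apply/eqP; rewrite eqEcard cycle_subG mem_cycle /= -mul_perm_conj -!orderE orderJ.
apply/trivgP/subsetP=> s /setIP[/cycleP[i defs] /cycleP[j defs']].
have s1 : (val w ^+ i)%R = 1%R.
  by rewrite -[LHS]mulr1 -mul_permX_E -defs defs' Frobenius_permX_E expr1n.
by apply/set1P/permP=> x; rewrite defs mul_permX_E s1 mul1r perm1.
Qed.

End GammaL1.

Section Cases.
Variables (gT : finGroupType) (a phi : gT) (p f : nat).
Variables (k : nat) (sigma : nat_pred) (c : gT) (H : {group gT}).

Definition admissible : Prop :=
  [/\ k %| f,
      forall r, r \in sigma -> (r \in \pi((p ^ k - 1)%N)) && (r \in \pi(f)),
      generator (cyclic_part <[a]> sigma) c
    & (f`_sigma^')%N %| k].

Definition case_a : Prop :=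
  cyclic_part <[a]> sigma^' ><| <[c * phi ^+ k]> = H
  /\ (2%N \notin sigma \/ (p ^ k)%N = 1 %[mod 4]).

Definition case_b : Prop :=
  [/\ cyclic_part <[a]> sigma^'
        ><| (cyclic_part <[a ^+ 2]> 2 * <[c * phi ^+ k]>) = H,
      2 \in sigma
    & (p ^ k)%N = 3 %[mod 4]].

End Cases.

(* Main.v *)
Require Import Defs.
From mathcomp Require Import all_boot all_order all_algebra all_fingroup.
From mathcomp Require Import all_solvable all_field.
From mathcomp Require Import zify ring.

(* Write the elements of GammaL_1(p^f) as phi^i a^j; such an element maps 1 to
   w^j. If H meets <a> in <a^d> and is generated modulo <a^d> by phi^k a^e, then
   (phi^k a^e)^m = phi^(km) a^(e (1 + q + ... + q^(m-1))) with q = p^k, so H is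
   transitive iff the numbers e (q^m - 1) / (q - 1) cover all residues modulo d.
   As for linear congruential generators (Hull-Dobell), this holds iff e is prime
   to d, q = 1 modulo every prime divisor of d, and q = 1 modulo 4 if 4 divides d.
   With sigma = pi(d), a transitive H is thus seen to contain a transitive group
   of type (a) or (b), and counting shows that the latter are minimal: a group of
   type (a) has order p^f - 1, and one of type (b) has order (p^f - 1) f_2 / 2.
   The statement on Sylow subgroups follows from Hilbert 90: elements of prime
   order outside <a> have fixed points, so a Sylow r-subgroup of a regular
   subgroup has only one subgroup of order r. *)

Set Implicit Arguments.
Unset Strict Implicit.
Unset Printing Implicit Defensive.

Import GRing.Theory.

(** * Geometric sums modulo d *)

Section GeometricSums.
Local Open Scope nat_scope.

(** For q > 1 this is (q^m - 1) / (q - 1), kept as a sum so that it can be reduced modulo divisors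
    of q - 1. *)
Definition geom (q m : nat) := \sum_(i < m) q ^ i.

Lemma geom0 q : geom q 0 = 0.
Proof. exact: big_ord0. Qed.

Lemma geomS q m : geom q m.+1 = geom q m + q ^ m.
Proof. exact: big_ord_recr. Qed.

Lemma geomD q m j : geom q (m + j) = geom q m + q ^ m * geom q j.
Proof.
elim: j => [|j IHj]; first by rewrite geom0 muln0 !addn0.
by rewrite addnS !geomS IHj expnD; ring.
Qed.

Lemma geomM q m j : geom q (m * j) = geom q m * geom (q ^ m) j.
Proof.
elim: j => [|j IHj]; first by rewrite muln0 !geom0 muln0.
by rewrite mulnS addnC geomD geomS IHj expnM; ring.
Qed.

Lemma exp_mod1 r q m : q = 1 %[mod r] -> q ^ m = 1 %[mod r].
Proof. by move=> q1; rewrite -modnXm q1 modnXm exp1n. Qed.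

Lemma geom_mod r q m : q = 1 %[mod r] -> geom q m = m %[mod r].
Proof.
move=> q1; elim: m => [|m IHm]; first by rewrite geom0.
by rewrite geomS -modnDm IHm (exp_mod1 _ q1) modnDm addn1.
Qed.

Lemma dvdn_geom_mod r q m : q = 1 %[mod r] -> (r %| geom q m) = (r %| m).
Proof. by move=> q1; rewrite /dvdn geom_mod. Qed.

(** Split a prime r off m = j r: in [geom q j * geom (q ^ j) r] the second factor is congruent to r,
    hence to 0, modulo r. *)
Lemma dvdn_geom q m : 0 < m -> (forall r, prime r -> r %| m -> q = 1 %[mod r]) ->
  m %| geom q m.
Proof.
elim/ltn_ind: m => -[//|[//|m]] IHm _ q1.
have [r pr_r r_m] : exists2 r, prime r & r %| m.+2.
  by exists (pdiv m.+2); rewrite ?pdiv_prime ?pdiv_dvd.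
have [j def_m] := dvdnP r_m; rewrite def_m geomM.
have j_gt0 : 0 < j by rewrite lt0n; apply/negP=> /eqP j0; rewrite j0 in def_m.
apply: dvdn_mul.
  apply: IHm => //; first by rewrite def_m ltn_Pmulr ?prime_gt1.
  by move=> s pr_s s_j; apply: q1; rewrite // def_m dvdn_mulr.
by rewrite dvdn_geom_mod //; apply/exp_mod1/q1.
Qed.

Lemma exp1D_mod_sqr r t i : exists s, (1 + r * t) ^ i = 1 + i * (r * t) + r ^ 2 * s.
Proof.
elim: i => [|i [s IHi]]; first by exists 0; rewrite muln0 !addn0.
exists (i * t ^ 2 + s + s * r * t); rewrite expnS IHi mulSn; ring.
Qed.

(** The binomial coefficient arises from summing (1 + r t)^i = 1 + i r t modulo r^2 over i < m. *)
Lemma geom1D_mod_sqr r t m :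
  exists s, geom (1 + r * t) m = m + r * t * 'C(m, 2) + r ^ 2 * s.
Proof.
elim: m => [|m [s IHm]]; first by exists 0; rewrite geom0 bin_small ?muln0.
have [u def_u] := exp1D_mod_sqr r t m.
by exists (s + u); rewrite geomS IHm def_u binS bin1; ring.
Qed.

Lemma mod1_decomp r q : 1 < r -> q = 1 %[mod r] -> q = 1 + r * (q %/ r).
Proof.
by move=> r_gt1 q1; rewrite {1}(divn_eq q r) q1 modn_small // addnC mulnC.
Qed.

(* For r = 2 this fails when q = 3 %[mod 4]: then geom q 2 = 1 + q. *)
Lemma geom_prime_sqr_ndvd r q : prime r -> q = 1 %[mod r] ->
  (r = 2 -> q = 1 %[mod 4]) -> ~~ (r ^ 2 %| geom q r).
Proof.
move=> pr_r q1 q4; have r_gt1 := prime_gt1 pr_r.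
have [r2 | r_odd] := even_prime pr_r.
  by move: (q4 r2); rewrite r2 !geomS geom0 expn0 expn1 -[2 ^ 2]/4; lia.
have [s] := geom1D_mod_sqr r (q %/ r) r; rewrite -mod1_decomp // => ->.
(* For odd r the term with the binomial coefficient vanishes modulo r^2, which leaves [geom q r]
   congruent to r. *)
have [u ->] : exists u, 'C(r, 2) = u * r.
  apply/dvdnP/prime_dvd_bin => //=; rewrite ltn_neqAle r_gt1 andbT.
  by apply: contraTneq r_odd => <-.
rewrite (_ : _ + _ = r + r ^ 2 * (q %/ r * u + s)); last by ring.
rewrite (dvdn_addl _ (dvdn_mulr _ (dvdnn _))); apply/negP=> /(dvdn_leq (prime_gt0 pr_r)).
by rewrite leqNgt -{1}(expn1 r) ltn_exp2l.
Qed.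

Lemma prime_common_divisor m n : 0 < n -> ~~ coprime m n ->
  exists r, [/\ prime r, r %| m & r %| n].
Proof.
move=> n_gt0 nco; exists (pdiv (gcdn m n)).
have/andP[-> ->] : (pdiv (gcdn m n) %| m) && (pdiv (gcdn m n) %| n).
  by rewrite -dvdn_gcd pdiv_dvd.
by rewrite pdiv_prime // ltn_neqAle eq_sym nco gcdn_gt0 n_gt0 orbT.
Qed.

(* The Hull-Dobell condition on the multiplier q modulo d. *)
Definition transitive_modulus (q d : nat) : Prop :=
  (forall r, prime r -> r %| d -> q = 1 %[mod r]) /\ (4 %| d -> q = 1 %[mod 4]).

(** Induction on d = d' r with r prime. As r divides [geom q j], it divides j = i r, and
    [geom q j = geom q r * geom (q ^ r) i]. Here [geom q r] is r times a number u prime to d', so d'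
    divides [geom (q ^ r) i] and induction applies to q^r. *)
Lemma geom_dvdn q d j : 0 < d -> transitive_modulus q d -> d %| geom q j -> d %| j.
Proof.
elim/ltn_ind: d q j => -[//|[_ q j _ _ _|m]]; first exact: dvd1n.
move=> IHd q j _ [q1 q4].
have [r pr_r r_d] : exists2 r, prime r & r %| m.+2.
  by exists (pdiv m.+2); rewrite ?pdiv_prime ?pdiv_dvd.
have qr1 := q1 r pr_r r_d.
have r_gt0 := prime_gt0 pr_r.
have [d def_d] := dvdnP r_d; rewrite def_d in q1 q4 *.
have d_gt0 : 0 < d by rewrite lt0n; apply/negP=> /eqP d0; rewrite d0 in def_d.
have lt_d : d < m.+2 by rewrite def_d ltn_Pmulr ?prime_gt1.
move=> d_geom.
have : r %| geom q j by apply: dvdn_trans d_geom; rewrite dvdn_mull.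
rewrite dvdn_geom_mod // => /dvdnP[i def_j].
have /dvdnP[u def_u] : r %| geom q r by rewrite dvdn_geom_mod.
rewrite def_j; rewrite dvdn_pmul2r //.
(* A common prime s of u and d divides [geom q r], which is r modulo s, so s = r; but then r^2
   divides [geom q r]. *)
have co_du : coprime d u.
  rewrite coprime_sym; apply: contraT => /(prime_common_divisor d_gt0)[s [pr_s s_u s_d]].
  have qs1 : q = 1 %[mod s] by apply: q1 => //; rewrite dvdn_mulr.
  have [s_r | s'r] := eqVneq s r.
    have /negP[] : ~~ (r ^ 2 %| geom q r).
      apply: geom_prime_sqr_ndvd => // r2.
      by apply: q4; rewrite (@dvdn_mul 2 2) // -r2 // -s_r.
    by rewrite def_u -mulnn dvdn_pmul2r // -{1}s_r.
  have : s %| geom q r by rewrite def_u dvdn_mulr.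
  by rewrite dvdn_geom_mod // dvdn_prime2 // (negPf s'r).
apply: (IHd d lt_d (q ^ r)) => //.
  split=> [s pr_s s_d | d4]; apply: exp_mod1.
    by apply: q1; rewrite ?dvdn_mulr.
  by apply: q4; rewrite dvdn_mulr.
move: d_geom; rewrite def_j [i * r]mulnC geomM def_u mulnAC dvdn_pmul2r //.
by rewrite Gauss_dvdr.
Qed.

Lemma transitive_modulus_coprime q d : 0 < d -> transitive_modulus q d -> coprime q d.
Proof.
move=> d_gt0 [q1 _]; apply: contraT => /(prime_common_divisor d_gt0)[s [pr_s s_q s_d]].
have := q1 s pr_s s_d.
by rewrite (eqP s_q) modn_small ?prime_gt1.
Qed.

(** Pigeonhole: the values at m < d are distinct, since those at i <= j differ by e q^i
    [geom q (j - i)], and d divides j - i if this vanishes modulo d. *)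
Lemma geom_cover q d e : 0 < d -> coprime e d -> transitive_modulus q d ->
  forall x, exists m, e * geom q m = x %[mod d].
Proof.
move=> d_gt0 co_ed qd x.
have co_qd := transitive_modulus_coprime d_gt0 qd.
pose F (i : 'I_d) := Ordinal (ltn_pmod (e * geom q i) d_gt0).
have injF : injective F.
  suffices lt_inj (i j : 'I_d) : i <= j -> F i = F j -> i = j.
    by move=> i j; case/orP: (leq_total i j) => le_ij eqF; [|apply/esym]; apply: lt_inj.
  move=> le_ij [/esym/eqP]; rewrite -(subnKC le_ij) geomD mulnDr.
  rewrite -{2}[e * _]addn0 eqn_modDl mod0n -/(dvdn _ _).
  rewrite Gauss_dvdr 1?coprime_sym // Gauss_dvdr; last by rewrite coprime_sym coprimeXl.
  move/(geom_dvdn d_gt0 qd) => d_ij; apply/val_inj/eqP; rewrite eqn_leq le_ij /=.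
  rewrite -subn_eq0; case: posnP => // ij_gt0.
  by have := dvdn_leq ij_gt0 d_ij; have := ltn_ord j; lia.
have /codomP[m /(congr1 val)/= def_m] := injF_onto injF (Ordinal (ltn_pmod x d_gt0)).
by exists m.
Qed.

Lemma exp_mod4 q m : q = 3 %[mod 4] -> q ^ m %% 4 = if odd m then 3 else 1.
Proof.
move=> q3; elim: m => //= m IHm; rewrite expnS -modnMm q3 IHm.
by case: (odd m).
Qed.

Lemma exp_mod4_inv q k : q ^ k = 3 %[mod 4] -> q = 3 %[mod 4] /\ odd k.
Proof.
have [qe | q_odd] := boolP (~~ odd q).
  case: k => [//|k]; rewrite expnS => /(congr1 odd).
  by rewrite !odd_mod // oddM (negPf qe).
have [q1|q3] : q = 1 %[mod 4] \/ q = 3 %[mod 4] by lia.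
  by rewrite (exp_mod1 _ q1).
by rewrite exp_mod4 //; case: odd.
Qed.

Lemma geom_mod4 q m : q = 3 %[mod 4] -> geom q m %% 4 = odd m.
Proof.
move=> q3; elim: m => [|m IHm]; first by rewrite geom0.
by rewrite geomS -modnDm IHm exp_mod4 //=; case: (odd m).
Qed.

(* Conversely to geom_cover. If r divides d and q is not 1 modulo r, then
   (q - 1) * geom q m = q ^ m - 1 is never -1 modulo r; if 4 divides d and q = 3
   modulo 4, then geom q m is 0 or 1 modulo 4. *)
Lemma geom_cover_inv q d e : 0 < d -> coprime q d ->
    (forall x, exists m, e * geom q m = x %[mod d]) ->
  coprime e d /\ transitive_modulus q d.
Proof.
move=> d_gt0 co_qd cov.
have cov_r r x : r %| d -> exists m, e * geom q m = x %[mod r].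
  move=> r_d; have [m def_m] := cov x; exists m.
  by rewrite -(modn_dvdm _ r_d) def_m modn_dvdm.
have co_ed : coprime e d.
  apply: contraT => /(prime_common_divisor d_gt0)[r [pr_r r_e r_d]].
  have [m] := cov_r r 1 r_d; rewrite -modnMml (eqP r_e) mul0n mod0n.
  by rewrite modn_small ?prime_gt1.
have co_er r : r %| d -> coprime e r by move=> r_d; apply: coprime_dvdr co_ed.
split=> //; split=> [r pr_r r_d | d4].
  have [q0 | q_gt0] := posnP q.
    move: co_qd; rewrite q0 /coprime gcd0n => /eqP d1.
    by move: r_d pr_r; rewrite d1 dvdn1 => /eqP->.
  apply/eqP; rewrite eqn_mod_dvd //; apply: contraT => nr_q.
  have co_q1r : coprime r (q - 1) by rewrite prime_coprime.
  (* y is -1 modulo r and 0 modulo q - 1. With y = x (q - 1), an m for which [geom q m] is x modulo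
     r gives q^m = 1 + x (q - 1) = 0 modulo r. *)
  pose y := chinese r (q - 1) r.-1 0.
  have /dvdnP[x def_y] : q - 1 %| y by rewrite /dvdn chinese_modr // mod0n.
  have [m] := cov_r r (e * x) r_d.
  have eq_qm : e * q ^ m = e * geom q m * (q - 1) + e.
    rewrite -[LHS](_ : e * (q ^ m).-1.+1 = _); last by rewrite prednK ?expn_gt0 ?q_gt0.
    by rewrite predn_exp -/(geom q m) subn1 mulnS; ring.
  move=> def_m; have : r %| e * q ^ m.
    rewrite eq_qm /dvdn -modnDml -modnMml def_m modnMml -mulnA -def_y.
    rewrite -modnMmr chinese_modl // modnMmr modnDml -mulnSr prednK ?prime_gt0 //.
    by rewrite modnMl.
  rewrite Gauss_dvdr; last by rewrite coprime_sym co_er.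
  rewrite Euclid_dvdX // => /andP[r_q _].
  by have := coprime_dvdr r_d co_qd; rewrite coprime_sym prime_coprime // r_q.
have q_odd : odd q by rewrite -coprimen2; apply: coprime_dvdr co_qd; apply: dvdn_trans d4.
have e_odd : odd e by rewrite -coprimen2; apply: co_er; apply: dvdn_trans d4.
have [//|q3] : q = 1 %[mod 4] \/ q = 3 %[mod 4] by lia.
have [m] := cov_r 4 2 d4; rewrite -modnMmr geom_mod4 //.
by case: (odd m); [rewrite muln1 | rewrite muln0]; lia.
Qed.
End GeometricSums.

(** * Extensions of a cyclic group by a power automorphism *)

Section Semilinear.
Local Open Scope group_scope.

Variables (gT : finGroupType) (a phi : gT) (p f : nat).
Hypotheses (p_gt1 : 1 < p) (f_gt0 : 0 < f).
Hypotheses (order_a : #[a] = (p ^ f)%N.-1) (order_phi : #[phi] = f).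
Hypotheses (conj_a : a ^ phi = a ^+ p) (ti_a_phi : <[a]> :&: <[phi]> = 1).
Implicit Types (H K : {group gT}).

Let n := (p ^ f)%N.-1.
Let G := (<[a]> <*> <[phi]>)%G.

(** * Normal form of the elements, and the subgroups in terms of it *)

Definition semilin i j := phi ^+ i * a ^+ j.

Lemma card_units_gt0 : 0 < n.
Proof. by rewrite /n -subn1 subn_gt0 -(expn0 p) ltn_exp2l. Qed.
Let n_gt0 := card_units_gt0.

Lemma coprime_p_units : coprime p n.
Proof.
rewrite coprime_sym; apply: (@coprime_dvdr _ (p ^ f)); first exact: dvdn_exp.
by rewrite coprimePn // expn_gt0 ltnW.
Qed.

Lemma conj_aX i j : (a ^+ j) ^ (phi ^+ i) = a ^+ (j * p ^ i).
Proof.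
elim: i => [|i IHi]; first by rewrite conjg1 muln1.
by rewrite expgSr conjgM IHi conjXg conj_a -expgM expnS mulnCA.
Qed.

Lemma semilinM i j i' j' :
  semilin i j * semilin i' j' = semilin (i + i') (j * p ^ i' + j').
Proof.
by rewrite /semilin !expgD -conj_aX -!mulgA mulKVg.
Qed.

Lemma semilinX k e m : semilin k e ^+ m = semilin (k * m) (e * geom (p ^ k) m).
Proof.
elim: m => [|m IHm]; first by rewrite /semilin geom0 !muln0 mulg1.
by rewrite expgS IHm semilinM expnM mulnS geomS mulnDr [(_ + e * geom _ _)%N]addnC.
Qed.

Lemma semilin0 j : semilin 0 j = a ^+ j.
Proof. exact: mul1g. Qed.

Lemma semilin_mod i j : semilin (i %% f) (j %% n) = semilin i j.
Proof. by rewrite /semilin /n -order_a -order_phi !expg_mod_order. Qed.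

Lemma mem_aX j : a ^+ j \in G.
Proof. by rewrite groupX // -cycle_subG joing_subl. Qed.

Lemma normal_a_phi : <[phi]> \subset 'N(<[a]>).
Proof.
rewrite cycle_subG; apply/normP; rewrite -cycleJ conj_a; apply/eqP.
by rewrite eqEcard cycle_subG mem_cycle /= -conj_a -!orderE orderJ.
Qed.

Lemma mem_semilin i j : semilin i j \in G.
Proof. by rewrite groupM // groupX // -cycle_subG (joing_subl, joing_subr). Qed.

Lemma semilinP x : reflect (exists i j, x = semilin i j) (x \in G).
Proof.
apply: (iffP idP) => [|[i [j ->]]]; last exact: mem_semilin.
rewrite /= joingC norm_joinEl ?normal_a_phi //.
by case/mulsgP=> _ _ /cycleP[i ->] /cycleP[j ->] ->; exists i, j.
Qed.

Lemma semilin_eq i j i' j' : semilin i j = semilin i' j' ->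
  (i = i' %[mod f]) /\ (j = j' %[mod n]).
Proof.
move=> eq_g; have eq_phi : phi ^- i' * phi ^+ i = a ^+ j' * a ^- j.
  by apply: (mulIg (a ^+ j)); rewrite mulgKV -mulgA -/(semilin i j) eq_g mulKg.
have: phi ^- i' * phi ^+ i \in <[a]> :&: <[phi]>.
  by rewrite inE {1}eq_phi !groupM ?groupV ?mem_cycle.
rewrite ti_a_phi => /set1P phi1; split; apply/eqP.
  rewrite -order_phi -eq_expg_mod_order; apply/eqP.
  by rewrite -[LHS](mulKVg (phi ^+ i')) phi1 mulg1.
rewrite /n -order_a -eq_expg_mod_order; apply/eqP.
by rewrite -[RHS](mulgKV (a ^+ j)) -eq_phi phi1 mul1g.
Qed.

Lemma aX_mod_mem d j j' : d %| n -> (a ^+ j' * a ^- j \in <[a ^+ d]>) = (j' == j %[mod d]).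
Proof.
move=> d_n; have a_d x : (a ^+ x \in <[a ^+ d]>) = (d %| x).
  apply/idP/dvdnP=> [/cycleP[i]|[i ->]]; last by rewrite mulnC expgM mem_cycle.
  rewrite -expgM => /eqP; rewrite eq_expg_mod_order order_a => /eqP eq_x.
  by apply/dvdnP; rewrite /dvdn -(modn_dvdm _ d_n) eq_x modn_dvdm // modnMr.
without loss le_jj : j j' / j <= j'.
  move=> IH; case/orP: (leq_total j j') => [|le_jj]; first exact: IH.
  by rewrite eq_sym -IH // -groupV invMg invgK.
by rewrite eqn_mod_dvd // -a_d -{1}(subnK le_jj) expgD mulgK.
Qed.

Lemma aX_mem d j : d %| n -> (a ^+ j \in <[a ^+ d]>) = (d %| j).
Proof. by move=> d_n; have := aX_mod_mem 0 j d_n; rewrite mod0n invg1 mulg1. Qed.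

Lemma norm_aX d x : x \in G -> x \in 'N(<[a ^+ d]>).
Proof.
move=> Gx; have nsAG : <[a]> <| G by rewrite normalYl normal_a_phi.
have /char_normal_trans/(_ nsAG)/normal_norm/subsetP-> // : <[a ^+ d]> \char <[a]>.
by rewrite sub_cyclic_char ?cycle_cyclic // cycleX.
Qed.

Lemma order_aX d : d %| n -> #[a ^+ d] = n %/ d.
Proof. by move=> d_n; rewrite orderXdiv order_a. Qed.

(** The group [<[x ^+ m]>] lies in both factors and has order #[x] / gcd(#[x], m); the product
    formula then leaves a divisor of that gcd for the second factor. *)
Lemma card_mul_cycle_dvd (B : {group gT}) (x : gT) m :
  x ^+ m \in B -> #|B * <[x]>| %| #|B| * m.
Proof.
move=> Bxm; set g := gcdn #[x] m.
have g_gt0 : 0 < g by rewrite gcdn_gt0 order_gt0.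
have /dvdnP[y def_y] : #[x] %/ g %| #|B :&: <[x]>|.
  by rewrite -orderXgcd cardSg // cycle_subG inE Bxm groupX ?cycle_id.
have o_gt0 : 0 < #[x] %/ g by rewrite divn_gt0 // dvdn_leq ?dvdn_gcdl.
apply: dvdn_trans (dvdn_mul (dvdnn _) (dvdn_gcdr #[x] m)); apply/dvdnP; exists y.
apply/eqP; rewrite -(eqn_pmul2r o_gt0) -/g -mulnA [(g * _)%N]mulnC divnK ?dvdn_gcdl //.
by apply/eqP; rewrite orderE mul_cardG def_y; ring.
Qed.

(* As phi generates the stabiliser of 1 and a is regular, H is transitive iff
   <[phi]> * H is the whole group, i.e. iff H covers all powers of a. *)
Definition covers H := forall j, exists i, semilin i j \in H.

(** An element phi^i a^x of H has i = k m; dividing it by the m-th power of the generator leaves a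
    power of a in H, hence in [<[a ^+ d]>]. *)
Lemma covers_geom H d k e : 0 < k -> d %| n -> H :&: <[a]> = <[a ^+ d]> ->
    semilin k e \in H -> (forall i j, semilin i j \in H -> k %| i) ->
  covers H -> forall x, exists m, e * geom (p ^ k) m = x %[mod d].
Proof.
move=> k_gt0 d_n defHA Hg minK covH x; have [i Hi] := covH x.
have /dvdnP[m def_i] := minK _ _ Hi; exists m; apply/eqP.
rewrite eq_sym -aX_mod_mem // -defHA.
apply/setIP; split; last by rewrite groupM ?groupV ?mem_cycle.
have := groupM (groupVr (groupX m Hg)) Hi.
rewrite semilinX /semilin def_i mulnC invMg -mulgA mulKg => Ha.
by rewrite (_ : _ * _ = a ^- (e * geom (p ^ k) m) * a ^+ x) //; apply/commuteV/commuteX2.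
Qed.

Lemma covers_geom_inv H d k e : 0 < d -> d %| n -> <[a ^+ d]> \subset H ->
    semilin k e \in H -> coprime e d -> transitive_modulus (p ^ k) d ->
  covers H.
Proof.
move=> d_gt0 d_n sdH Hg co_ed qd x.
have [m def_x] := geom_cover d_gt0 co_ed qd x; exists (k * m)%N.
rewrite -[semilin _ _](mulKVg (semilin k e ^+ m)) groupMl ?groupX //.
rewrite semilinX /semilin invMg -mulgA mulKg.
rewrite (_ : _ * _ = a ^+ x * a ^- (e * geom (p ^ k) m)).
  by rewrite (subsetP sdH) // aX_mod_mem // def_x.
by apply/esym/commuteV/commuteX2.
Qed.

(** Take for d the index of [H :&: <[a]>] in [<[a]>], and for k the least positive exponent of phi
    in H, which exists because [semilin f 0] is 1. *)
Lemma semilin_structure H : H \subset G ->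
  exists d k e, [/\ 0 < d, d %| n, 0 < k & k %| f] /\
    [/\ H :&: <[a]> = <[a ^+ d]>, semilin k e \in H
       & forall i j, semilin i j \in H -> k %| i].
Proof.
move=> sHG; have [d [d_gt0 d_n defHA]] :
    exists d, [/\ 0 < d, d %| n & H :&: <[a]> = <[a ^+ d]>].
  have dv_n : #|H :&: <[a]>| %| #[a] by rewrite cardSg ?subsetIr.
  exists (n %/ #|H :&: <[a]>|)%N; rewrite /n -order_a; split.
  - by rewrite divn_gt0 // dvdn_leq.
  - by rewrite dvdn_div.
  have /setP/(_ (H :&: <[a]>)%G) := cycle_sub_group dv_n.
  by rewrite !inE subsetIr eqxx => /esym/eqP/(congr1 val).
have ex_k : exists k, (0 < k) && [exists e : 'I_n, semilin k e \in H].
  exists f; rewrite f_gt0; apply/existsP; exists (Ordinal n_gt0).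
  by rewrite /semilin /= mulg1 -order_phi expg_order group1.
have [k /andP[k_gt0 /existsP[e He]] min_k] := ex_minnP ex_k.
have minK i j : semilin i j \in H -> k %| i.
  move=> Hij; rewrite /dvdn; apply: contraT; rewrite -lt0n => r_gt0.
  have := min_k (i %% k); rewrite r_gt0 leqNgt ltn_pmod //= => -> //.
  (* The factor f - 1 replaces inversion: the exponent of phi becomes a multiple of f plus the
     remainder of i modulo k. *)
  have := groupM (groupX (i %/ k * f.-1)%N He) Hij.
  rewrite semilinX semilinM -semilin_mod => Hr; apply/existsP.
  exists (Ordinal (ltn_pmod (e * geom (p ^ k) (i %/ k * f.-1) * p ^ i + j) n_gt0)).
  rewrite -semilin_mod /= modn_mod; congr (semilin _ _ \in H): Hr.
  rewrite {2}(divn_eq i k) addnA.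
  rewrite (_ : k * _ + _ = (i %/ k * k) * f)%N ?modnMDl //.
  by rewrite -[in RHS](prednK f_gt0); ring.
exists d, k, e; split; split=> //.
by have := minK f 0; apply; rewrite /semilin mulg1 -order_phi expg_order group1.
Qed.

Lemma card_semilin : #|G| = (n * f)%N.
Proof.
by rewrite /= norm_joinEr ?normal_a_phi // TI_cardMg // -!orderE order_a order_phi.
Qed.

(** Covering gives [<[phi]> * H = G], and the product formula determines the order of H. *)
Lemma covers_card H : H \subset G -> covers H -> #|H| = (n * #|H :&: <[phi]>|)%N.
Proof.
move=> sHG covH; have defG : <[phi]> * H = G.
  apply/eqP; rewrite eqEsubset mul_subG ?joing_subr //=.
  apply/subsetP=> _ /semilinP[i [j ->]]; have [i' Hij] := covH j.
  apply/mulsgP; exists (phi ^+ i * phi ^- i') (semilin i' j) => //.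
    by rewrite groupM ?groupV ?mem_cycle.
  by rewrite /semilin -mulgA mulKg.
have := mul_cardG <[phi]> H; rewrite defG card_semilin -orderE order_phi.
rewrite -mulnA mulnCA => /eqP; rewrite eqn_pmul2l // => /eqP->.
by rewrite setIC.
Qed.

Lemma covers_dvd_card H : H \subset G -> covers H -> n %| #|H|.
Proof. by move=> sHG covH; rewrite (covers_card sHG covH) dvdn_mulr. Qed.

Lemma semilin_a i j : f %| i -> semilin i j = a ^+ j.
Proof. by move=> /eqP i0; rewrite -semilin_mod i0 semilin0 /n -order_a expg_mod_order. Qed.

Lemma semilin_id i j : f %| i -> n %| j -> semilin i j = 1.
Proof. by move=> /eqP i0 /eqP j0; rewrite -semilin_mod i0 j0 semilin0. Qed.

Lemma cyclic_part_cycle (x : gT) (pi : nat_pred) :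
  cyclic_part <[x]> pi = <[x ^+ #[x]`_pi^']>%G.
Proof.
apply: cyclic_part_uniq; rewrite ?cycle_cyclic ?cycleX //= -orderE.
rewrite orderXdiv ?dvdn_part // -{1}(partnC pi (order_gt0 x)).
by rewrite mulnK ?part_gt0.
Qed.

(** * Admissible data and groups of type (a) *)

Section Admissible.

Variables (k : nat) (sigma : nat_pred) (c : gT).
Hypothesis adm : admissible a p f k sigma c.
Let q := (p ^ k)%N.
Let h := c * phi ^+ k.
Let ns := (n`_sigma)%N.
Let ns' := (n`_sigma^')%N.

Lemma admissible_dvd : k %| f. Proof. by case: adm. Qed.
Lemma admissible_gt0 : 0 < k. Proof. exact: dvdn_gt0 f_gt0 admissible_dvd. Qed.

Lemma units_geom m : m %| f -> n = ((p ^ m).-1 * geom (p ^ m) (f %/ m))%N.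
Proof. by move=> m_f; rewrite /geom -predn_exp -expnM mulnC divnK. Qed.

Lemma admissible_mod r : prime r -> r \in sigma -> q = 1 %[mod r].
Proof.
move=> pr_r s_r; have [_ /(_ r s_r)/andP[q_r _] _ _] := adm.
have q_gt0 : 0 < q by rewrite expn_gt0 ltnW.
apply/eqP; rewrite eqn_mod_dvd //.
by move: q_r; rewrite mem_primes => /and3P[].
Qed.

Lemma admissible_dvd_f r : r \in sigma -> r %| f.
Proof.
move=> s_r; have [_ /(_ r s_r)/andP[_ f_r] _ _] := adm.
by move: f_r; rewrite mem_primes => /and3P[].
Qed.

Lemma admissible_modulus d : sigma.-nat d -> (4 %| d -> q = 1 %[mod 4]) ->
  transitive_modulus q d.
Proof.
move=> s_d d4; split=> // r pr_r r_d; apply: admissible_mod => //.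
by rewrite -pnatE // (pnat_dvd r_d).
Qed.

Lemma admissible_quotient : sigma.-nat (f %/ k).
Proof.
have [k_f _ _ fs_k] := adm; apply: pnat_dvd (part_pnat sigma f).
rewrite dvdn_divLR ?admissible_gt0 // -{1}(partnC sigma f_gt0).
exact: dvdn_mul.
Qed.

(** The primes r of f / k lie in sigma, so q = 1 modulo r; hence f / k divides [geom q (f %/ k)], a
    divisor of n. *)
Lemma quotient_dvd_units : f %/ k %| ns.
Proof.
have fk_gt0 : 0 < f %/ k by rewrite divn_gt0 ?admissible_gt0 // dvdn_leq ?admissible_dvd.
rewrite -(part_pnat_id admissible_quotient) partn_dvd //.
rewrite (units_geom admissible_dvd) dvdn_mull //; apply: dvdn_geom => // r pr_r r_fk.
by apply: admissible_mod; rewrite // -pnatE // (pnat_dvd r_fk) ?admissible_quotient.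
Qed.

(** Here c = a^(ns' u) with u prime to ns; moving phi^k to the left multiplies the exponent by q,
    which is prime to n. *)
Lemma admissible_gen : exists e, [/\ h = semilin k e, coprime e ns & ns' %| e].
Proof.
have [_ _ gen_c _] := adm; rewrite cyclic_part_cycle order_a -/n -/ns' /= in gen_c.
have /cycleP[u def_c] : c \in <[a ^+ ns']> by rewrite (eqP gen_c) cycle_id.
exists (ns' * u * q)%N; split; last by rewrite -mulnA dvdn_mulr.
  by rewrite /h conjgC def_c -expgM conj_aX.
have co_uns : coprime ns u.
  move: gen_c; rewrite def_c generator_coprime order_aX ?dvdn_part //.
  by rewrite -{1}(partnC sigma n_gt0) mulnK ?part_gt0.
rewrite !coprimeMl [coprime u _]coprime_sym co_uns coprimeXl; last first.
  by rewrite (coprime_dvdr _ coprime_p_units) ?dvdn_part.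
by rewrite coprime_sym coprime_partC.
Qed.

Lemma norm_gen d : <[h]> \subset 'N(<[a ^+ d]>).
Proof.
by have [e [-> _ _]] := admissible_gen; rewrite cycle_subG norm_aX ?mem_semilin.
Qed.

Lemma cyclic_part_compl : cyclic_part <[a]> sigma^' = <[a ^+ ns]>%G.
Proof. by rewrite cyclic_part_cycle order_a partnNK. Qed.

(** In h^ns the exponent k ns of phi is a multiple of f, and the exponent e [geom q ns] of a is a
    multiple of ns' ns = n. *)
Lemma order_gen_dvd : #[h] %| ns.
Proof.
have [e [-> _ e_ns']] := admissible_gen; rewrite order_dvdn semilinX; apply/eqP.
apply: semilin_id.
  by rewrite -(divnK admissible_dvd) mulnC dvdn_mul ?quotient_dvd_units.
rewrite -(partnC sigma n_gt0) mulnC dvdn_mul // dvdn_geom ?part_gt0 // => r pr_r r_ns.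
by apply: admissible_mod; rewrite // -pnatE // (pnat_dvd r_ns) ?part_pnat.
Qed.

Lemma sigma_group_ti (K : {group gT}) : sigma.-nat #|K| -> <[a ^+ ns]> :&: K = 1.
Proof.
move=> sK; apply: coprime_TIg; rewrite -orderE order_aX ?dvdn_part //.
rewrite -{1}(partnC sigma n_gt0) mulKn ?part_gt0 // coprime_sym.
exact: pnat_coprime sK (part_pnat _ _).
Qed.

Lemma case_a_sdprod : cyclic_part <[a]> sigma^' ><| <[h]> = <[a ^+ ns]> <*> <[h]>.
Proof.
rewrite cyclic_part_compl; apply: sdprodEY; first exact: norm_gen.
by apply: sigma_group_ti; apply: pnat_dvd order_gen_dvd (part_pnat _ _).
Qed.

Lemma order_a_sigma : #[a ^+ ns] = ns'.
Proof.
by rewrite order_aX ?dvdn_part // -{1}(partnC sigma n_gt0) mulKn ?part_gt0.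
Qed.

Lemma case_a_covers H : case_a a phi p k sigma c H -> covers H.
Proof.
rewrite /case_a case_a_sdprod => -[defH two].
have [e [def_h co_e _]] := admissible_gen.
apply: (@covers_geom_inv H ns k e) => //; rewrite ?dvdn_part ?part_gt0 //.
- by rewrite -defH joing_subl.
- by rewrite -defH -def_h -cycle_subG joing_subr.
apply: admissible_modulus; first exact: part_pnat.
move=> ns4; case: two => // /negP[]; rewrite -pnatE //.
by apply: pnat_dvd (part_pnat sigma n); apply: dvdn_trans ns4.
Qed.

(** Covering makes n divide the order, while the two factors have order ns' and a divisor of ns. *)
Lemma case_a_card H : H \subset G -> case_a a phi p k sigma c H -> #|H| = n.
Proof.
move=> sHG caseH; have [defH _] := caseH.
apply/eqP; rewrite eqn_dvd covers_dvd_card ?andbT //; last exact: case_a_covers.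
rewrite -(sdprod_card defH) cyclic_part_compl /= -!orderE order_a_sigma.
by rewrite -(partnC sigma n_gt0) mulnC dvdn_mul ?order_gen_dvd.
Qed.

(** * Groups of type (b) *)

Section CaseB.

Hypotheses (sigma2 : 2 \in sigma) (q3 : q = 3 %[mod 4]).
(** A group of type (b) contains [<[a ^+ (2 * t)]>]. As t is odd, 2 t escapes the condition modulo 4
    of [transitive_modulus]. *)
Let t := (ns`_2^')%N.
Let B := <[a ^+ (2 * n`_2^')]>.

Lemma units_even : 2 %| n.
Proof.
rewrite (units_geom admissible_dvd) dvdn_mulr // -subn1 -eqn_mod_dvd ?expn_gt0 1?ltnW //.
exact/eqP/admissible_mod.
Qed.

Lemma half_gt0 : 0 < n %/ 2. Proof. by rewrite divn_gt0 // dvdn_leq ?units_even. Qed.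

Lemma cyclic_part_sqr : cyclic_part <[a ^+ 2]> 2 = B :> {set gT}.
Proof.
rewrite cyclic_part_cycle /= -expgM order_aX ?units_even // /B; congr (<[a ^+ (2 * _)]>).
rewrite -{2}(divnK units_even) partnM ?half_gt0 //.
by rewrite [(2`_2^')%N]part_p'nat ?muln1 // pnatE // !inE.
Qed.

Lemma part2_double : (n`_2 = 2 * (n`_2 %/ 2))%N.
Proof.
have := partn_dvd 2 n_gt0 units_even; rewrite part_pnat_id ?pnat_id // => n2.
by rewrite mulnC divnK.
Qed.

Lemma part2_sigma : (ns`_2 = n`_2)%N.
Proof. by rewrite partn_part // => r; rewrite inE => /eqP->. Qed.

Lemma units_factor : (n = ns' * n`_2 * t)%N.
Proof. by rewrite -part2_sigma -mulnA partnC ?part_gt0 // mulnC partnC. Qed.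

Lemma units_odd_factor : (n`_2^' = ns' * t)%N.
Proof.
apply/eqP; rewrite -(eqn_pmul2l (part_gt0 2 n)) partnC //.
by rewrite {1}units_factor mulnAC mulnC.
Qed.

Lemma quotient_double_dvd : (n`_2 %/ 2 * ns' = n %/ (2 * t))%N.
Proof.
have t_gt0 : 0 < t by apply: part_gt0.
apply/eqP; rewrite {2}units_factor {2}part2_double.
by rewrite (_ : _ * _ * t = n`_2 %/ 2 * ns' * (2 * t))%N ?mulnK ?muln_gt0 //; ring.
Qed.

Lemma double_t_dvd : 2 * t %| n.
Proof.
apply/dvdnP; exists (ns' * (n`_2 %/ 2))%N.
by rewrite {1}units_factor {1}part2_double; ring.
Qed.

Lemma double_odd_dvd : 2 * n`_2^' %| n.
Proof. by rewrite -{2}(partnC 2 n_gt0) part2_double -mulnAC dvdn_mulr. Qed.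

Lemma order_B : #|B| = n`_2 %/ 2.
Proof.
rewrite -orderE order_aX ?double_odd_dvd // -{1}(partnC 2 n_gt0) {1}part2_double.
by rewrite mulnAC mulKn // muln_gt0 part_gt0.
Qed.

Lemma gen_p_mod4 : p = 3 %[mod 4]. Proof. by have [] := exp_mod4_inv q3. Qed.

Lemma gen_k_odd : odd k. Proof. by have [] := exp_mod4_inv q3. Qed.

Lemma gen_f_even : 2 %| f. Proof. exact: admissible_dvd_f. Qed.

Lemma sigma_half : sigma.-nat (n`_2 %/ 2).
Proof.
apply: pnat_dvd (part_pnat sigma n); rewrite -/ns.
apply: dvdn_trans (dvdn_part 2 ns); rewrite part2_sigma.
by rewrite {2}part2_double dvdn_mull.
Qed.

Lemma sigma_B : sigma.-nat #|B|. Proof. by rewrite order_B sigma_half. Qed.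

Lemma case_b_comm : B * <[h]> = B <*> <[h]>.
Proof. by rewrite norm_joinEr // norm_gen. Qed.

Lemma case_b_sdprod :
  cyclic_part <[a]> sigma^' ><| (cyclic_part <[a ^+ 2]> 2 * <[h]>)
    = <[a ^+ ns]> <*> (B <*> <[h]>).
Proof.
rewrite cyclic_part_sqr case_b_comm cyclic_part_compl.
apply: (@sdprodEY _ _ (B <*> <[h]>)%G).
  by rewrite join_subG norm_gen cycle_subG norm_aX ?mem_aX.
apply: sigma_group_ti; have := mul_cardG B <[h]>; rewrite /= case_b_comm => def_card.
rewrite (@pnat_dvd _ (#|B| * #[h])) ?orderE ?def_card ?dvdn_mulr // -def_card.
by rewrite pnatM -orderE (pnat_dvd order_gen_dvd) ?part_pnat // sigma_B.
Qed.

(** The subgroups B and [<[a ^+ ns]>] have coprime orders, whose product is the order of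
    [<[a ^+ (2 * t)]>]; in a cyclic group divisibility of orders gives inclusion. *)
Lemma case_b_kernel H : case_b a phi p k sigma c H -> <[a ^+ (2 * t)]> \subset H.
Proof.
rewrite /case_b case_b_sdprod => -[defH _ _].
have HA K : K \subset <[a]> -> K \subset H -> K \subset H :&: <[a]>.
  by move=> sKA sKH; rewrite subsetI sKH.
apply: subset_trans (subsetIl _ <[a]>).
rewrite -(cardSg_cyclic (cycle_cyclic a)) ?cycleX ?subsetIr // -orderE.
rewrite order_aX ?double_t_dvd // -quotient_double_dvd Gauss_dvd.
  rewrite -{1}order_B -{1}order_a_sigma !cardSg // HA ?cycleX //.
    by rewrite -defH joing_subl.
  by rewrite -defH (subset_trans (joing_subl _ <[h]>)) ?joing_subr.
exact: pnat_coprime sigma_half (part_pnat _ _).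
Qed.

(** The modulus used is 2 t: it divides ns, so e is prime to it, and 4 does not divide it. *)
Lemma case_b_covers H : case_b a phi p k sigma c H -> covers H.
Proof.
move=> caseH; have [+ _ _] := caseH; rewrite case_b_sdprod => defH.
have [e [def_h co_e _]] := admissible_gen.
have t2 : 2 * t %| ns.
  rewrite -[X in _ %| X](partnC 2 (part_gt0 sigma n)) dvdn_mul // part2_sigma.
  by rewrite part2_double dvdn_mulr.
apply: (@covers_geom_inv H (2 * t) k e) => //; rewrite ?muln_gt0 ?part_gt0 ?double_t_dvd //.
- exact: case_b_kernel.
- by rewrite -def_h -cycle_subG -defH joingA joing_subr.
- exact: coprime_dvdr t2 co_e.
apply: admissible_modulus; first by apply: pnat_dvd t2 (part_pnat _ _).
rewrite (@dvdn_pmul2l 2 2) // => t_even.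
by have := part_pnat 2^' ns; rewrite -/t => /(pnat_dvd t_even); rewrite pnatE.
Qed.

(* The generator h has order dividing t * (f / k)_2 modulo B. *)
Lemma case_b_card_dvd H : case_b a phi p k sigma c H ->
  #|H| %| ns' * (n`_2 %/ 2) * (t * f`_2).
Proof.
case=> defH _ _; rewrite -(sdprod_card defH) cyclic_part_compl cyclic_part_sqr.
rewrite /= -!orderE order_a_sigma -mulnA dvdn_mul // -order_B.
have [e [def_h co_e e_ns']] := admissible_gen.
apply: (@card_mul_cycle_dvd <[_]>); rewrite -/h def_h semilinX.
have t_gt0 : 0 < t by apply: part_gt0.
(* The exponent of phi is a multiple of f: the odd part of f / k divides t, and its 2-part divides
   f_2. *)
rewrite semilin_a; last first.
  rewrite -{1}(divnK admissible_dvd) mulnC dvdn_mul //.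
  have fk_gt0 : 0 < f %/ k by rewrite divn_gt0 ?admissible_gt0 // dvdn_leq ?admissible_dvd.
  rewrite -(partnC 2 fk_gt0) mulnC dvdn_mul ?partn_dvd ?part_gt0 ?quotient_dvd_units //.
  by rewrite dvdn_div ?admissible_dvd.
(* The exponent of a must be a multiple of 2 ns' t: ns' divides e, and the coprime numbers 2 and t
   divide the geometric sum. *)
rewrite aX_mem ?double_odd_dvd // units_odd_factor mulnCA dvdn_mul // mulnC.
have f2 : 2 %| t * f`_2.
  rewrite dvdn_mull //; have := partn_dvd 2 f_gt0 gen_f_even.
  by rewrite part_pnat_id ?pnat_id.
rewrite Gauss_dvd; last by rewrite coprime_sym (pnat_coprime (pnat_id _)) ?part_pnat.
rewrite geomM dvdn_mulr.
  by rewrite -geomM dvdn_geom_mod //; apply: admissible_mod.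
apply: dvdn_geom => // r pr_r r_t; apply: admissible_mod; rewrite // -pnatE //.
apply: pnat_dvd (part_pnat sigma n); apply: dvdn_trans r_t _.
by rewrite -/ns dvdn_part.
Qed.

(** Only the factor h^m matters modulo 2: its exponents are k m and e [geom q m], with k and e odd
    and [geom q m] of the parity of m. As f and n are even, parities of exponents are well
    defined. *)
Lemma case_b_parity H i j : case_b a phi p k sigma c H ->
  semilin i j \in H -> odd i = odd j.
Proof.
case=> defH _ _; have [_ <- _ _] := sdprodP defH.
rewrite cyclic_part_compl cyclic_part_sqr /B /= => /mulsgP[_ y /cycleP[u ->]].
case/mulsgP=> _ _ /cycleP[v ->] /cycleP[m ->] -> {y}.
have [e [def_h co_e e_ns']] := admissible_gen.
rewrite -/h def_h semilinX -!expgM -!semilin0 !semilinM => /semilin_eq[eq_i eq_j].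
have odd_mod2 x y z : 2 %| z -> x = y %[mod z] -> odd x = odd y.
  by rewrite dvdn2 => /negbTE z2 eq_xy; rewrite -[LHS](odd_mod x z2) eq_xy odd_mod.
rewrite (odd_mod2 _ _ _ gen_f_even eq_i) (odd_mod2 _ _ _ units_even eq_j).
have ns_even : 2 %| ns.
  by apply: dvdn_trans (dvdn_part 2 ns); rewrite part2_sigma part2_double dvdn_mulr.
have e_odd : odd e by rewrite -coprimen2; apply: coprime_dvdr co_e.
have /negbTE ns_odd : ~~ odd ns by rewrite -dvdn2.
have geom_odd : odd (geom (p ^ k) m) = odd m.
  by apply: (odd_mod2 _ _ 2) => //; apply/geom_mod/admissible_mod.
by rewrite !add0n !oddD !oddM ns_odd gen_k_odd e_odd geom_odd.
Qed.

Lemma part2_dvd_2 m : 0 < m -> ~~ (4 %| m) -> m`_2 %| 2.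
Proof.
move=> m_gt0 m4; rewrite p_part (@dvdn_exp2l 2 _ 1) //.
by move: m4; rewrite (@pfactor_dvdn 2 2) // -ltnNge.
Qed.

(** The image of K modulo [<[a]>] contains that of phi^k1, which has order f / k1. *)
Lemma semilin_card_dvd K d1 k1 e1 : K \subset G -> d1 %| n -> k1 %| f ->
  K :&: <[a]> = <[a ^+ d1]> -> semilin k1 e1 \in K -> (n %/ d1) * (f %/ k1) %| #|K|.
Proof.
move=> sKG d1_n k1_f defKA Kg; rewrite -(dvdn_pmul2r n_gt0).
have := mul_cardG K <[a]>; rewrite /= -orderE order_a -/n => ->.
rewrite defKA -[#|<[_]>|]orderE order_aX // -mulnA mulnC dvdn_mul //.
have nAK : K \subset 'N(<[a]>) by apply/subsetP=> x /(subsetP sKG)/(@norm_aX 1).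
rewrite -norm_joinEl // -order_phi -(orderXdiv _) ?order_phi // /n -order_a orderE.
have ti : <[phi ^+ k1]> :&: <[a]> = 1.
  by apply/trivgP; rewrite -ti_a_phi /= setIC setIS ?cycleX.
rewrite orderE -(TI_cardMg ti) -norm_joinEl; last first.
  by rewrite (subset_trans _ normal_a_phi) ?cycleX.
rewrite cardSg // join_subG joing_subr andbT cycle_subG.
rewrite -(mulgK (a ^+ e1) (phi ^+ k1)) groupM ?groupV //.
  by rewrite (subsetP (joing_subl _ _)).
by rewrite (subsetP (joing_subr _ _)) ?mem_cycle.
Qed.

(** By parity d1 is even; so e1, prime to d1, is odd, and hence k1 is odd. Thus p^k1 = 3 modulo 4,
    which forbids 4 to divide d1, and the order of K is a multiple of (n_2 / 2) f_2. It is also a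
    multiple of n, so it reaches the upper bound for the order of H. *)
Lemma case_b_min H K : H \subset G -> case_b a phi p k sigma c H ->
  K \subset H -> covers K -> K = H.
Proof.
move=> sHG caseH sKH covK; have sKG := subset_trans sKH sHG.
have [d1 [k1 [e1 [[d1_gt0 d1_n k1_gt0 k1_f] [defKA Kg minK]]]]] := semilin_structure sKG.
have cov1 := covers_geom k1_gt0 d1_n defKA Kg minK covK.
have [|co_e1 [_ d1_4]] := geom_cover_inv d1_gt0 _ cov1.
  by rewrite coprimeXl // (coprime_dvdr d1_n) // coprime_p_units.
have d1_even : ~~ odd d1.
  rewrite -(case_b_parity (i := 0) caseH) // semilin0 (subsetP sKH) // -cycle_subG -defKA.
  exact: subsetIl.
have k1_odd : odd k1.
  rewrite (case_b_parity caseH (subsetP sKH _ Kg)) -coprimen2.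
  by apply: coprime_dvdr co_e1; rewrite dvdn2.
have d1n4 : ~~ (4 %| d1).
  by apply/negP=> /d1_4; rewrite exp_mod4 ?gen_p_mod4 // k1_odd.
apply/val_inj/eqP; rewrite /= eqEcard sKH dvdn_leq //=.
apply: dvdn_trans (case_b_card_dvd caseH) _.
rewrite (_ : _ * _ = n`_2^' * (n`_2 %/ 2 * f`_2))%N; last by rewrite units_odd_factor; ring.
have half2 : 2.-nat (n`_2 %/ 2).
  by apply: pnat_dvd (part_pnat 2 n); rewrite {2}part2_double dvdn_mull.
rewrite Gauss_dvd; last first.
  by rewrite coprime_sym (pnat_coprime _ (part_pnat _ _)) // pnatM half2 part_pnat.
rewrite (dvdn_trans (dvdn_part _ _) (covers_dvd_card sKG covK)) /=.
apply: dvdn_trans (semilin_card_dvd sKG d1_n k1_f defKA Kg); apply: dvdn_mul.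
  have nd_gt0 : 0 < n %/ d1 by rewrite divn_gt0 // dvdn_leq.
  apply: dvdn_trans (dvdn_part 2 _); rewrite -(@dvdn_pmul2l 2) // -part2_double.
  by rewrite -{1}(divnK d1_n) partnM // mulnC dvdn_mul // part2_dvd_2.
have fk_gt0 : 0 < f %/ k1 by rewrite divn_gt0 // dvdn_leq.
apply: dvdn_trans (dvdn_part 2 _); rewrite -{1}(divnK k1_f) partnM //.
by rewrite [(k1`_2)%N]part_p'nat ?muln1 // p'natE // dvdn2 k1_odd.
Qed.

Lemma case_b_card H : f = 2 %[mod 4] -> H \subset G -> case_b a phi p k sigma c H ->
  #|H| = n.
Proof.
move=> f2 sHG caseH; apply/eqP.
rewrite eqn_dvd covers_dvd_card ?andbT //; last exact: case_b_covers.
apply: dvdn_trans (case_b_card_dvd caseH) _.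
rewrite {2}units_factor {2}part2_double.
rewrite (_ : ns' * _ * t = ns' * (n`_2 %/ 2) * (t * 2))%N; last by ring.
rewrite !dvdn_mul // part2_dvd_2 //.
by rewrite /dvdn f2.
Qed.

(** The a-part of h^(2t) lies in [<[a ^+ (2 * t)]>], so phi^(2kt) lies in H and is trivial. Thus f
    divides 2 k t with k and t odd, while f is even. *)
Lemma case_b_stab H : case_b a phi p k sigma c H ->
  H :&: <[phi]> = 1 -> f = 2 %[mod 4].
Proof.
move=> caseH tiH; have sH := case_b_kernel caseH.
have Hh : h \in H.
  have [+ _ _] := caseH; rewrite case_b_sdprod -cycle_subG => <-.
  by rewrite joingA joing_subr.
have t_gt0 : 0 < t by apply: part_gt0.
have [e [def_h _ _]] := admissible_gen.
have f_dvd : f %| k * (2 * t).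
  rewrite -[X in X %| _]order_phi order_dvdn -in_set1 -[[set 1]]tiH inE mem_cycle andbT.
  rewrite -(mulgK (a ^+ (e * geom q (2 * t))) (phi ^+ _)).
  rewrite -/(semilin _ _) -semilinX -def_h groupM ?groupX ?groupV //.
  rewrite (subsetP sH) // aX_mem ?double_t_dvd // dvdn_mull //.
  apply: dvdn_geom; rewrite ?muln_gt0 // => r pr_r r_2t.
  apply: admissible_mod; rewrite // -pnatE // (pnat_dvd r_2t) // pnatM pnatE // sigma2.
  apply: pnat_dvd (part_pnat sigma n); exact: dvdn_part.
have t_odd : odd t by rewrite -coprimen2 (pnat_coprime (part_pnat 2^' ns)) // pnatNK pnat_id.
have k_odd := gen_k_odd.
have f_even := gen_f_even.
have f_n4 : ~~ (4 %| f).
  apply/negP=> /dvdn_trans/(_ f_dvd); rewrite mulnCA (@dvdn_pmul2l 2 2) //.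
  by rewrite dvdn2 oddM k_odd t_odd.
by lia.
Qed.

End CaseB.
End Admissible.

(** * Transitive groups contain one of type (a) or (b) *)

Lemma order_constt_coprime (pi : nat_pred) e :
  (forall r, r \in pi -> prime r -> ~~ (r %| e)) -> #[(a ^+ e).`_pi] = (n`_pi)%N.
Proof.
move=> pi_e; rewrite order_constt orderXgcd order_a -/n; set g := gcdn n e.
have g_gt0 : 0 < g by rewrite gcdn_gt0 n_gt0.
have ng_gt0 : 0 < n %/ g by rewrite divn_gt0 // dvdn_leq ?dvdn_gcdl.
rewrite -[in RHS](divnK (dvdn_gcdl n e)) -/g partnM //.
rewrite [(g`_pi)%N]part_p'nat ?muln1 //; apply/pnatP=> // r pr_r r_g.
by apply/negP=> /pi_e/(_ pr_r)/negP[]; apply: dvdn_trans r_g (dvdn_gcdr _ _).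
Qed.

Lemma constt_mem_cycle (pi : nat_pred) e : (a ^+ e).`_pi \in <[a ^+ n`_pi^']>.
Proof.
rewrite -cycle_subG -(cardSg_cyclic (cycle_cyclic a)) ?cycleX ?cycle_subG //; last first.
  by rewrite groupX ?mem_cycle.
rewrite -!orderE order_constt (order_aX (dvdn_part _ _)).
rewrite -{1}(partnC pi n_gt0) mulnK ?part_gt0 //.
by rewrite partn_dvd // /n -order_a order_dvdG ?mem_cycle.
Qed.

Lemma covers_contains_case H : H \subset G -> covers H ->
  exists (k : nat) (sigma : nat_pred) (c : gT) (H0 : {group gT}),
    [/\ H0 \subset H, admissible a p f k sigma c
       & case_a a phi p k sigma c H0 \/ case_b a phi p k sigma c H0].
Proof.
move=> sHG covH.
have [d [k [e [[d_gt0 d_n k_gt0 k_f] [defHA Hg minK]]]]] := semilin_structure sHG.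
have [|co_e q_mod] := geom_cover_inv d_gt0 _ (covers_geom k_gt0 d_n defHA Hg minK covH).
  by rewrite coprimeXl // (coprime_dvdr d_n) // coprime_p_units.
have [q1 q4] := q_mod.
have sdH : <[a ^+ d]> \subset H by rewrite -defHA subsetIl.
pose sigma : nat_pred := \pi(d).
have sigmaP r : r \in sigma -> prime r /\ r %| d by rewrite mem_primes => /and3P[].
have s_d : sigma.-nat d by apply: pnat_pi.
have fk_gt0 : 0 < f %/ k by rewrite divn_gt0 // dvdn_leq.
(* Being prime to d, m keeps e' prime to d, because [geom (p ^ k) m] is m modulo each prime of d. *)
pose m := ((f %/ k)`_sigma^')%N; pose k' := (k * m)%N; pose e' := (e * geom (p ^ k) m)%N.
have q'1 r : p ^ k = 1 %[mod r] -> p ^ k' = 1 %[mod r].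
  by move=> q_r; rewrite expnM (exp_mod1 _ q_r).
have e'_sigma r : r \in sigma -> prime r -> ~~ (r %| e').
  move=> s_r pr_r; have [_ r_d] := sigmaP r s_r.
  rewrite Euclid_dvdM // negb_or dvdn_geom_mod ?q1 //.
  rewrite -!prime_coprime // coprime_sym (coprime_dvdr r_d) //=.
  by apply: pnat_coprime (_ : sigma.-nat r) (part_pnat _ _); rewrite pnatE.
pose c0 := (a ^+ e').`_sigma; pose b := (a ^+ e').`_sigma^'.
(* The conjugation turns phi^k' c0 into c phi^k'. *)
pose c := c0 ^ phi ^- k'.
have def_h : c * phi ^+ k' = semilin k e ^+ m * b^-1.
  rewrite semilinX -/k' -/e' /semilin -{1}(consttC sigma (a ^+ e')) -/c0 -/b.
  by rewrite mulgA mulgK -conjgCV.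
have adm : admissible a p f k' sigma c.
  split.
  - by rewrite /k' -{1}(divnK k_f) mulnC dvdn_mul ?dvdn_part.
  - move=> r /sigmaP[pr_r r_d]; rewrite !mem_primes pr_r f_gt0 /=.
    have k'_gt0 : 0 < k' by rewrite muln_gt0 k_gt0 part_gt0.
    rewrite subn_gt0 -{1}(expn0 p) ltn_exp2l // k'_gt0 -eqn_mod_dvd ?expn_gt0 1?ltnW //.
    rewrite q'1 ?q1 // eqxx /=.
    (* The power of phi^k a^e with exponent f / k lies in [<[a]>], so d divides this exponent of a;
       as e is prime to r, it follows that r divides f / k. *)
    have : a ^+ (e * geom (p ^ k) (f %/ k)) \in <[a ^+ d]>.
      rewrite -defHA inE mem_cycle andbT -(semilin_a (i := k * (f %/ k))).
        by rewrite -semilinX groupX.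
      by rewrite mulnC divnK.
    rewrite aX_mem // => /(dvdn_trans r_d); rewrite Gauss_dvdr; last first.
      by rewrite coprime_sym (coprime_dvdr r_d).
    by rewrite dvdn_geom_mod ?q1 // => /dvdn_trans-> //; rewrite dvdn_div.
  - rewrite /generator (@cyclic_part_uniq _ <[a]> <[c]>) ?cycle_cyclic //=.
      rewrite cycle_subG memJ_norm.
        exact: subsetP (cycleX a _) _ (constt_mem_cycle _ _).
      by rewrite groupV -cycle_subG (subset_trans _ normal_a_phi) ?cycleX.
    by rewrite /= -!orderE orderJ order_constt_coprime // order_a.
  rewrite -{1}(divnK k_f) partnM // mulnC dvdn_mul //; exact: dvdn_part.
have s_ns : <[a ^+ n`_sigma]> \subset H.
  apply: subset_trans sdH; rewrite cycle_subG aX_mem //.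
  by rewrite -(part_pnat_id s_d) partn_dvd.
have sh : <[c * phi ^+ k']> \subset H.
  rewrite cycle_subG def_h groupM ?groupX ?groupV //.
  by rewrite (subsetP s_ns) // -[in X in _ \in X](partnNK sigma) constt_mem_cycle.
have [sigma2 | s2] := boolP (2 \in sigma); last first.
  exists k', sigma, c, (<[a ^+ n`_sigma]> <*> <[c * phi ^+ k']>)%G.
  by split; rewrite // ?join_subG ?s_ns //; left; split; [apply: case_a_sdprod | left].
have [q'4 | q'4] := eqVneq (p ^ k' %% 4) (1 %% 4).
  exists k', sigma, c, (<[a ^+ n`_sigma]> <*> <[c * phi ^+ k']>)%G.
  by split; rewrite // ?join_subG ?s_ns //; left; split; [apply: case_a_sdprod | right].
have q'3 : p ^ k' = 3 %[mod 4].
  by have := admissible_mod adm (isT : prime 2) sigma2; move: q'4; lia.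
exists k', sigma, c.
exists (<[a ^+ n`_sigma]> <*> (<[a ^+ (2 * n`_2^')]> <*> <[c * phi ^+ k']>))%G.
split; rewrite // ?join_subG ?s_ns ?sh ?andbT //=; last first.
  by right; split=> //; apply: case_b_sdprod.
apply: subset_trans sdH; rewrite cycle_subG aX_mem //.
(* If 4 divided d, then p^k and hence p^k' would be 1 modulo 4; so the 2-part of d divides 2. *)
rewrite -(partnC 2 d_gt0) dvdn_mul ?partn_dvd // part2_dvd_2 //.
by apply: contra q'4 => /q4/q'1->.
Qed.

Lemma minimally_covers_iff H : H \subset G ->
  covers H /\ (forall K, K \subset H -> covers K -> K = H) <->
  exists (k : nat) (sigma : nat_pred) (c : gT), admissible a p f k sigma c /\
    (case_a a phi p k sigma c H \/ case_b a phi p k sigma c H).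
Proof.
move=> sHG; split=> [[covH minH]|[k [sigma [c [adm caseH]]]]].
  have [k [sigma [c [H0 [sH0H adm caseH0]]]]] := covers_contains_case sHG covH.
  exists k, sigma, c; split=> //; suffices <- : H0 = H by [].
  apply: minH => //; case: caseH0 => [|caseb]; first exact: case_a_covers.
  by have [_ s2 _] := caseb; apply: case_b_covers caseb.
case: caseH => [caseH | caseH].
  split=> [|K sKH covK]; first exact: case_a_covers caseH.
  apply/val_inj/eqP; rewrite eqEcard sKH (case_a_card adm sHG caseH) dvdn_leq //.
  exact: covers_dvd_card (subset_trans sKH sHG) covK.
have [_ s2 q3] := caseH; split=> [|K]; first exact: case_b_covers caseH.
exact: case_b_min caseH.
Qed.

(** By [covers_card], order n forces a trivial intersection with [<[phi]>], as [case_b_stab]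
    requires. *)
Lemma case_card_iff H k sigma c : H \subset G -> admissible a p f k sigma c ->
    case_a a phi p k sigma c H \/ case_b a phi p k sigma c H ->
  #|H| = n <->
    case_a a phi p k sigma c H \/ (f = 2 %[mod 4] /\ case_b a phi p k sigma c H).
Proof.
move=> sHG adm caseH; split=> [oH|[caseHa|[f2 caseHb]]].
- case: caseH => caseH; [by left | right; split=> //].
  have [_ s2 q3] := caseH; apply: (case_b_stab adm s2 q3 caseH).
  have := covers_card sHG (case_b_covers adm s2 caseH); rewrite oH => /eqP.
  rewrite -[X in X == _]muln1 eqn_pmul2l // eq_sym => /eqP tiH.
  by apply/eqP; rewrite trivg_card1 tiH.
- exact: case_a_card caseHa.
by have [_ s2 q3] := caseHb; apply: case_b_card caseHb.
Qed.

End Semilinear.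

(** * The action on the nonzero field elements *)

Section FieldAction.
Local Open Scope group_scope.

Variables (p f : nat) (F : finFieldType) (w : {unit F}).
Hypotheses (pcharFp : p \in [pchar F]%R) (f_gt0 : 0 < f) (cardF : #|F| = (p ^ f)%N).
Hypothesis gen_w : generator [set: {unit F}] w.
Implicit Types H K : {group {perm F}}.

Let a := mul_perm w.
Let phi := Frobenius_perm pcharFp.
Let GL := GammaL1 w pcharFp.
Let S := units_set F.
Let n := (p ^ f)%N.-1.

Lemma pchar_gt1 : 1 < p. Proof. exact/prime_gt1/(pcharf_prime pcharFp). Qed.
Let p_gt1 := pchar_gt1.

Lemma order_a : #[a] = (p ^ f)%N.-1.
Proof. by rewrite order_mul_perm ?cardF. Qed.

Lemma order_phi : #[phi] = f.
Proof. exact: order_Frobenius_perm. Qed.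

Lemma conj_a_phi : a ^ phi = a ^+ p.
Proof. exact: mul_perm_conj. Qed.

Lemma ti_a_phi : <[a]> :&: <[phi]> = 1.
Proof. by have [] := sdprodP (GammaL1_sdprod w pcharFp). Qed.

Lemma semilin_one i j : semilin a phi i j 1%R = (val w ^+ j)%R.
Proof. by rewrite permM Frobenius_permX_E expr1n mul_permX_E mulr1. Qed.

Lemma unitsP x : reflect (exists j, x = val w ^+ j)%R (x \in S).
Proof.
rewrite inE; apply: (iffP idP) => [x0 | [j ->]]; last first.
  by rewrite expf_neq0 // -unitfE (valP w).
have Ux : x \is a GRing.unit by rewrite unitfE.
have /cycleP[j def_x] : FinRing.unit F Ux \in <[w]> by rewrite -(eqP gen_w) inE.
by exists j; rewrite -FinRing.val_unitX -def_x.
Qed.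

Lemma card_units_set : #|S| = n.
Proof.
have -> : S = [set~ 0%R] by apply/setP=> x; rewrite !inE.
by rewrite cardsC1 cardF.
Qed.

Lemma one_units : 1%R \in S. Proof. by rewrite inE oner_neq0. Qed.

Lemma transitive_covers H : H \subset GL -> [transitive H, on S | 'P] <-> covers a phi H.
Proof.
move=> sHG; split=> [trH j | covH].
  have : (val w ^+ j)%R \in S by apply/unitsP; exists j.
  rewrite -(atransP trH _ one_units) => /orbitP[x Hx].
  have [i [j' def_x]] := semilinP conj_a_phi _ (subsetP sHG _ Hx).
  rewrite /= apermE def_x semilin_one => eq_w; exists i.
  rewrite (_ : semilin _ _ i j = x) // def_x; congr (_ * _); apply/permP=> y.
  by rewrite !mul_permX_E eq_w.
apply/imsetP; exists 1%R; first exact: one_units.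
apply/setP=> x; apply/unitsP/orbitP=> [[j ->] | [g Hg <-]].
  by have [i Hij] := covH j; exists (semilin a phi i j) => //; rewrite /= apermE semilin_one.
have [i [j ->]] := semilinP conj_a_phi _ (subsetP sHG _ Hg).
by exists j; rewrite /= apermE semilin_one.
Qed.

Lemma regular_card H : H \subset GL -> regular_on H S <-> covers a phi H /\ #|H| = n.
Proof.
move=> sHG; rewrite /regular_on; split=> [[trH regH] | [covH oH]].
  split; first exact/transitive_covers.
  rewrite -(card_orbit_stab 'P H 1%R) (atransP trH _ one_units) regH ?one_units //.
  by rewrite cards1 muln1 card_units_set.
have trH : [transitive H, on S | 'P] by apply/transitive_covers.
split=> // x Sx; apply/eqP; rewrite trivg_card1.
have := card_orbit_stab 'P H x; rewrite (atransP trH _ Sx) oH card_units_set.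
by rewrite -[X in _ = X]muln1 => /eqP; rewrite eqn_pmul2l ?card_units_gt0.
Qed.

(* Hilbert 90: an element of order r outside <a> has a power phi ^ (f / r) * a ^ j,
   with j a multiple of p ^ (f / r) - 1, hence conjugate to phi ^ (f / r) under <a>. *)
Lemma prime_order_fixed_point x r : x \in GL -> prime r -> x ^+ r = 1 -> x \notin <[a]> ->
  exists2 y, y \in S & x y = y.
Proof.
move=> /(semilinP conj_a_phi)[i [j def_x]] pr_r xr1 notAx.
have r_gt0 := prime_gt0 pr_r.
have f_ni : ~~ (f %| i).
  by apply: contra notAx => f_i; rewrite def_x (semilin_a order_a order_phi) ?mem_cycle.
have semilin_eq0 i' j' : semilin a phi i' j' = 1 -> f %| i' /\ n %| j'.
  have -> : 1 = semilin a phi 0 0 by rewrite /semilin mulg1.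
  case/(semilin_eq order_a order_phi ti_a_phi)=> eq_i eq_j.
  by rewrite /dvdn eq_i eq_j !mod0n.
have f_ir : f %| i * r.
  by move: xr1; rewrite def_x (semilinX conj_a_phi) => /semilin_eq0[].
have r_f : r %| f.
  apply: contraR f_ni; rewrite -prime_coprime // coprime_sym => co_fr.
  by rewrite -(Gauss_dvdl i co_fr).
pose f' := (f %/ r)%N; have def_f : f = (f' * r)%N by rewrite divnK.
have f'_f : f' %| f by rewrite dvdn_div.
have /dvdnP[u def_i] : f' %| i by rewrite -(dvdn_pmul2r r_gt0) -def_f.
have r_nu : ~~ (r %| u).
  by apply: contra f_ni => r_u; rewrite def_i def_f mulnC dvdn_mul.
have u_gt0 : 0 < u by case: posnP r_nu => // ->; rewrite dvdn0.
have co_ru : coprime r u by rewrite prime_coprime.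
(* Since s u = 1 + v r, the power x^s has phi-exponent f' modulo f, and x is recovered as its u-th
   power. *)
have [s v def_su _] := egcdnP r u_gt0; rewrite gcdnC (eqP co_ru) in def_su.
pose Q := (p ^ f')%N; pose z := x ^+ s.
have [j' def_z] : exists j', z = semilin a phi f' j'.
  exists (j * geom (p ^ i) s)%N; rewrite /z def_x (semilinX conj_a_phi).
  rewrite -(semilin_mod order_a order_phi) -[RHS](semilin_mod order_a order_phi).
  congr (semilin _ _ _ _); rewrite def_i mulnAC [(u * s)%N]mulnC def_su mulnDl mul1n.
  by rewrite -mulnA [(r * _)%N]mulnC -def_f modnMDl.
have def_x' : x = z ^+ u by rewrite -expgM def_su expgD mulnC expgM xr1 expg1n mul1g.
(* From z^r = 1, n = (Q - 1) [geom Q r] divides j' [geom Q r]. *)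
have [j'' def_j'] : exists j'', j' = (j'' * Q.-1)%N.
  have : z ^+ r = 1 by rewrite -expgM mulnC expgM xr1 expg1n.
  rewrite def_z (semilinX conj_a_phi) => /semilin_eq0[_].
  rewrite /n (units_geom p f'_f) (_ : f %/ f' = r)%N; last first.
    by rewrite {1}def_f mulKn // divn_gt0 // dvdn_leq.
  rewrite dvdn_pmul2r; first by move/dvdnP.
  by rewrite -(prednK r_gt0) geomS addn_gt0 !expn_gt0 (ltnW p_gt1) orbT.
pose y := (val w ^+ j'')%R; have y0 : y != 0%R by rewrite expf_neq0 // -unitfE (valP w).
exists y^-1%R; first by rewrite inE invr_eq0.
(* The image of y^-1 under z is w^j' y^-Q = y^(Q-1) y^-Q. *)
have fix_z : z y^-1%R = y^-1%R.
  have Q_gt0 : 0 < Q by rewrite expn_gt0 ltnW.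
  rewrite def_z permM Frobenius_permX_E mul_permX_E def_j' exprM -/y -/Q.
  by rewrite -{2}(prednK Q_gt0) exprSr exprVn mulrA divff ?mul1r // expf_neq0.
rewrite -apermE def_x'; apply/astab1P; rewrite groupX //.
by apply/astab1P; rewrite /= apermE.
Qed.

(** Regularity and [prime_order_fixed_point] put the elements of order r of P into [<[a]>]. So
    ['Ohm_1(P)] is that of a nontrivial cyclic r-group and has order r, which [prime_Ohm1P] turns
    into the two alternatives. *)
Lemma regular_Sylow H r (P : {group {perm F}}) : H \subset GL -> regular_on H S ->
  prime r -> r.-Sylow(H) P ->
  cyclic P \/ (r = 2 /\ exists2 m : nat, 2 < m & P \isog 'Q_(2 ^ m)).
Proof.
move=> sHG [_ regH] pr_r sylP.
have [sPH rP _] := and3P sylP.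
have [-> | ntP] := eqVneq P 1%G; first by left; apply: cyclic1.
have sOA : 'Ldiv_(r ^ 1)(P) \subset <[a]>.
  apply/subsetP=> x; rewrite inE => /andP[Px]; rewrite inE => /eqP xr1.
  apply: contraT => notAx; have Hx := subsetP sPH x Px.
  have [y Sy fix_y] := prime_order_fixed_point (subsetP sHG x Hx) pr_r xr1 notAx.
  have : x \in 'C_H[y | 'P] by rewrite inE Hx; apply/astab1P.
  by rewrite regH // => /set1P x1; rewrite x1 group1 in notAx.
have cycC : cyclic (P :&: <[a]>) by apply: cyclicS (subsetIr _ _) (cycle_cyclic a).
have eqO : 'Ohm_1(P) = 'Ohm_1(P :&: <[a]>).
  apply/eqP; rewrite eqEsubset [X in _ && X]OhmS ?subsetIl // andbT -{1}Ohm_id OhmS //.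
  by rewrite subsetI Ohm_sub /= (OhmE 1 rP) gen_subG.
have rC : r.-group (P :&: <[a]>) by apply: pgroupS (subsetIl _ _) rP.
have ntC : P :&: <[a]> != 1 by rewrite -(Ohm1_eq1 (P :&: <[a]>)%G) /= -eqO Ohm1_eq1.
have := elimT (prime_Ohm1P rC ntC); rewrite cycC -eqO => /(_ isT).
case/(prime_Ohm1P rP ntP)/orP=> [|/andP[/eqP r2 /eqP/quaternion_classP]]; first by left.
by right.
Qed.

End FieldAction.

(** * Translation to minimal transitivity and regularity *)

Local Open Scope group_scope.

Theorem corollary2p4 (p f : nat) (F : finFieldType) (w : {unit F})
    (pr_p : prime p) (f_gt0 : 0 < f) (cardF : #|F| = (p ^ f)%N)
    (gen_w : generator [set: {unit F}] w) :
  let pcharFp := card_finPcharP cardF pr_p in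
  let a := mul_perm w in
  let phi := Frobenius_perm pcharFp in
  let GL := GammaL1 w pcharFp in
  let S := units_set F in
  [/\ forall H : {group {perm F}}, H \subset GL ->
        (minimally_transitive H S <->
         exists (k : nat) (sigma : nat_pred) (c : {perm F}),
           admissible a p f k sigma c /\
           (case_a a phi p k sigma c H \/ case_b a phi p k sigma c H)),
      forall H : {group {perm F}}, H \subset GL ->
        forall (k : nat) (sigma : nat_pred) (c : {perm F}),
          admissible a p f k sigma c ->
          case_a a phi p k sigma c H \/ case_b a phi p k sigma c H ->
          (regular_on H S <->
           case_a a phi p k sigma c H \/
           (f = 2 %[mod 4] /\ case_b a phi p k sigma c H))
    & forall H : {group {perm F}}, H \subset GL -> regular_on H S ->
        forall (r : nat) (P : {group {perm F}}), prime r -> r.-Sylow(H) P ->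
          cyclic P \/
          (r = 2 /\ exists2 n : nat, 2 < n & P \isog 'Q_(2 ^ n))].
Proof.
move=> pcharFp a phi GL S.
have p_gt1 := prime_gt1 pr_p.
have oa : #[a] = (p ^ f).-1 := order_a cardF gen_w.
have ophi : #[phi] = f := order_phi pcharFp f_gt0 cardF.
have conj_a : a ^ phi = a ^+ p := conj_a_phi w pcharFp.
have ti : <[a]> :&: <[phi]> = 1 := ti_a_phi w pcharFp.
have trP (H : {group {perm F}}) :
  H \subset GL -> [transitive H, on S | 'P] <-> covers a phi H.
  exact: transitive_covers.
have regP (H : {group {perm F}}) :
  H \subset GL -> regular_on H S <-> covers a phi H /\ #|H| = (p ^ f).-1.
  exact: regular_card.
split=> [H sHG | H sHG k sigma c adm caseH | H sHG regH r P].
- apply: iff_trans (minimally_covers_iff p_gt1 f_gt0 oa ophi conj_a ti sHG).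
  split=> [[trH minH] | [covH minH]].
    split=> [|K sKH covK]; first exact/trP.
    apply/val_inj/eqP; rewrite eqEproper sKH /=; apply/negP=> /minH/negP[].
    by apply/trP; first exact: subset_trans sKH sHG.
  split=> [|K /andP[sKH nsHK]]; first exact/trP.
  apply/negP=> /(trP K (subset_trans sKH sHG)) covK.
  by rewrite (minH K sKH covK) subxx in nsHK.
- rewrite regP // -(case_card_iff p_gt1 f_gt0 oa ophi conj_a ti sHG adm caseH).
  split=> [[] // | oH]; split=> //.
  (* The equivalence is used backwards: being of type (a) or (b) already yields covering. *)
  have minH : exists k sigma c, admissible a p f k sigma c /\
      (case_a a phi p k sigma c H \/ case_b a phi p k sigma c H).
    by exists k, sigma, c.
  by have [] := (minimally_covers_iff p_gt1 f_gt0 oa ophi conj_a ti sHG).2 minH.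
exact: (regular_Sylow f_gt0 cardF gen_w sHG regH).
Qed.
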